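(* $$\lim_{F_{\mathrm{nb}}}M_{n,\lfloor n/2\rfloor}\,[\![(\exists x)(\exists y)(\exists z)(x\ne y\wedge E(x,z)\wedge E(y,z))]\!]=\mathbf 0.$$
   Context: Setup. $L_{all}$ is the first-order language with a name for every relation and function on $\mathbb N$. Fix an $\aleph_1$-saturated nonstandard model $\mathcal M$ of the true theory $\mathrm{Th}_{L_{all}}(\mathbb N)$, with $\mathbb N\subseteq\mathcal M$ as an initial segment, and a nonstandard number $n\in\mathcal M\setminus\mathbb N$. Finite sets, functions, sequences and trees are coded by numbers; for a set $S$ coded in $\mathcal M$, $|S|\in\mathcal M$ is its cardinality. Any sequence of standard finite objects $\{a_k\}_k$ is given by a function symbol of $L_{all}$ and hence has a value $a_n\in\mathcal M$ at index $n$. $\mathrm{st}(q)\in\mathbb R$ denotes the standard part of a finite $\mathcal M$-rational $q$; $q$ is infinitesimal if $|q|<1/k$ for all standard $k\ge1$. $\mathcal M_n\subseteq\mathcal M$ is the set of numbers bounded above by $2^{n^{1/t}}$ for some $t\in\mathcal M\setminus\mathbb N$. Sample space. $M_{k,\lfloor k/2\rfloor}$ is the set of all $\{E\}$-structures on $\{0,\dots,k-1\}$ in which $E$ is the graph of a function from $\{0,\dots,k-1\}$ to $\{0,\dots,\lfloor k/2\rfloor-1\}$ ($E(x,y)$ iff $y$ is the image of $x$); $M_{n,\lfloor n/2\rfloor}$ is its value at index $n$. For $\omega\in M_{n,\lfloor n/2\rfloor}$, $E_\omega$ is its relation and the neighbor of $i<n$ in $\omega$ is the image of $i$ under the function whose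 graph is $\omega$. Boolean algebra. $\mathcal A$ is the Boolean algebra of all subsets of $M_{n,\lfloor n/2\rfloor}$ coded in $\mathcal M$; $\mathcal I$ is the ideal of those $A\in\mathcal A$ with $|A|/|M_{n,\lfloor n/2\rfloor}|$ infinitesimal; $\mathcal B=\mathcal A/\mathcal I$ is a complete Boolean algebra with least element $\mathbf 0$, greatest element $\mathbf 1$ and measure $\mu(A/\mathcal I)=\mathrm{st}(|A|/|M_{n,\lfloor n/2\rfloor}|)$. Trees. $\mathcal T_{\mathrm{nb}}$ is the set of all labeled rooted trees coded in $\mathcal M$ such that: each non-leaf node is labeled by some $v\in\{0,\dots,n-1\}$ and has for each $u\in\{0,\dots,n-1\}$ an outgoing edge labeled $u$; each leaf is labeled by some element of $\mathcal M_n$; the depth (maximal number of edges in a path from the root) is at most $n^{1/t}$ (rounded to an element of $\mathcal M$) for some $t\in\mathcal M\setminus\mathbb N$. The computation of $T$ on $\omega$ starts at the root, and at a node labeled $v$ follows the edge labeled by the neighbor of $v$ in $\omega$, until a leaf is reached; the label of the leaf is the output $T(\omega)$. $F_{\mathrm{nb}}$ is the set of all functions on $M_{n,\lfloor n/2\rfloor}$ computed by some $T\in\mathcal T_{\mathrm{nb}}$, and $U(F_{\mathrm{nb}})$ is the set of those $\alpha\in F_{\mathrm{nb}}$ with $\alpha(\omega)\in\{0,\dots,n-1\}$ for all $\omega$. Wide limit. $\lim_{F_{\mathrm{nb}}}M_{n,\lfloor n/2\rfloor}$ is the $\mathcal B$-valued $\{E\}$-structure with universe $U(F_{\mathrm{nb}})$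 and truth values $[\![\alpha=\beta]\!]=\{\omega:\alpha(\omega)=\beta(\omega)\}/\mathcal I$, $[\![E(\alpha,\beta)]\!]=\{\omega:E_\omega(\alpha(\omega),\beta(\omega))\}/\mathcal I$; $[\![-]\!]$ commutes with $\neg,\wedge,\vee$; $[\![(\exists x)A(x)]\!]=\bigvee_{\alpha\in U(F_{\mathrm{nb}})}[\![A(\alpha)]\!]$, $[\![(\forall x)A(x)]\!]=\bigwedge_{\alpha\in U(F_{\mathrm{nb}})}[\![A(\alpha)]\!]$. *)

(* Defs.v *)
From HB Require Import structures.
From mathcomp Require Import all_boot all_order finmap.
From mathcomp Require Import generic_quotient.
From mathcomp Require Import boolp classical_sets cardinality.
From Stdlib Require Rdefinitions Raxioms Rpower.

Set Implicit Arguments.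
Unset Strict Implicit.
Unset Printing Implicit Defensive.

Import Order.TTheory.

Local Open Scope quotient_scope.

Record signature := Signature { fsym : nat -> Type; rsym : nat -> Type }.

(* [term S m] and [formula S m] have their free variables in ['I_m]; the
   quantifiers bind the variable [ord0] and shift the others by one. *)
Inductive term (S : signature) (m : nat) : Type :=
| Var of 'I_m
| App k of fsym S k & ('I_k -> term S m).

Inductive formula (S : signature) : nat -> Type :=
| FEq m of term S m & term S m : formula S m
| FRel m k of rsym S k & ('I_k -> term S m) : formula S m
| FNot m of formula S m : formula S m
| FAnd m of formula S m & formula S m : formula S m
| FOr m of formula S m & formula S m : formula S m
| FEx m of formula S m.+1 : formula S m
| FAll m of formula S m.+1 : formula S m.

Arguments Var {S m}.
Arguments App {S m k}.
Arguments FRel {S m k}.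

Definition noenv {T : Type} (i : 'I_0) : T := False_rect T (notF (ltn_ord i)).

Definition scons {T : Type} m (a : T) (e : 'I_m -> T) (i : 'I_m.+1) : T :=
  oapp e a (unlift ord0 i).

Fixpoint teval (S : signature) (U : Type)
    (I : forall k, fsym S k -> ('I_k -> U) -> U)
    m (e : 'I_m -> U) (t : term S m) : U :=
  match t with
  | Var i => e i
  | App k f ts => I k f (fun i => teval I e (ts i))
  end.

Record structure (S : signature) := Structure {
  dom :> Type;
  fint : forall k, fsym S k -> ('I_k -> dom) -> dom;
  rint : forall k, rsym S k -> ('I_k -> dom) -> Prop }.

Arguments fint {S} _ {k}.
Arguments rint {S} _ {k}.

Fixpoint sat (S : signature) (M : structure S) m (phi : formula S m) :
    ('I_m -> M) -> Prop :=
  match phi in formula _ m return ('I_m -> M) -> Prop with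
  | FEq m s t => fun e => teval (@fint S M) e s = teval (@fint S M) e t
  | FRel m k r ts => fun e => rint M r (fun i => teval (@fint S M) e (ts i))
  | FNot m A => fun e => ~ sat A e
  | FAnd m A B => fun e => sat A e /\ sat B e
  | FOr m A B => fun e => sat A e \/ sat B e
  | FEx m A => fun e => exists a : M, sat A (scons a e)
  | FAll m A => fun e => forall a : M, sat A (scons a e)
  end.

(* A formula in the variable [ord0], with parameters from [M]. *)
Record pformula (S : signature) (M : structure S) := PFormula {
  parity : nat;
  pform : formula S parity.+1;
  params : 'I_parity -> M }.

Arguments params {S M} p _.

Definition psat (S : signature) (M : structure S) (p : pformula M) (a : M) :=
  sat (pform p) (scons a (params p)).

(* Every type over a countable set [A] of parameters is realized. *)
Definition aleph1_saturated (S : signature) (M : structure S) : Prop :=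
  forall (A : set M) (Gamma : set (pformula M)),
    countable A ->
    (forall p, Gamma p -> forall i, A (params p i)) ->
    (forall s : seq (pformula M), (forall p, List.In p s -> Gamma p) ->
       exists a, forall p, List.In p s -> psat p a) ->
    exists a, forall p, Gamma p -> psat p a.

Record bstructure (S : signature) d (B : ctbDistrLatticeType d) := BStructure {
  bdom :> Type;
  bfint : forall k, fsym S k -> ('I_k -> bdom) -> bdom;
  beq : bdom -> bdom -> B;
  brel : forall k, rsym S k -> ('I_k -> bdom) -> B }.

(* In a complete algebra the default values [\top] and [\bot] are never used. *)
Definition bsup d (B : ctbDistrLatticeType d) (X : set B) : B :=
  xget \top%O (supremums X).
Definition binf d (B : ctbDistrLatticeType d) (X : set B) : B :=
  xget \bot%O (infimums X).

Fixpoint truth (S : signature) d (B : ctbDistrLatticeType d)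
    (K : bstructure S B) m (phi : formula S m) : ('I_m -> K) -> B :=
  match phi in formula _ m return ('I_m -> K) -> B with
  | FEq m s t => fun e => beq (teval (@bfint _ _ _ K) e s)
                              (teval (@bfint _ _ _ K) e t)
  | FRel m k r ts => fun e => brel r (fun i => teval (@bfint _ _ _ K) e (ts i))
  | FNot m A => fun e => (~` truth A e)%O
  | FAnd m A C => fun e => (truth A e `&` truth C e)%O
  | FOr m A C => fun e => (truth A e `|` truth C e)%O
  | FEx m A => fun e => bsup (range (fun a : K => truth A (scons a e)))
  | FAll m A => fun e => binf (range (fun a : K => truth A (scons a e)))
  end.

Inductive graph_rel : nat -> Type := Edge : graph_rel 2.
Definition graph_sig : signature := Signature (fun=> void) graph_rel.

(* Every function and relation on [nat] is its own name. *)
Definition Lall : signature :=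
  Signature (fun k => ('I_k -> nat) -> nat) (fun k => ('I_k -> nat) -> Prop).

Definition stdN : structure Lall :=
  @Structure Lall nat (fun _ f v => f v) (fun _ R v => R v).

(* [phi : formula Lall 0] is a sentence. *)
Definition true_arithmetic (M : structure Lall) : Prop :=
  forall phi : formula Lall 0,
    sat phi (noenv : 'I_0 -> stdN) ->
    sat phi (noenv : 'I_0 -> M).

Notation i30 := (@Ordinal 3 0 isT).
Notation i31 := (@Ordinal 3 1 isT).
Notation i32 := (@Ordinal 3 2 isT).

Definition fs1 (f : nat -> nat) : fsym Lall 1 := fun v => f (v ord0).
Definition fs2 (f : nat -> nat -> nat) : fsym Lall 2 :=
  fun v => f (v ord0) (v ord_max).
Definition fs3 (f : nat -> nat -> nat -> nat) : fsym Lall 3 :=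
  fun v => f (v i30) (v i31) (v i32).
Definition rs2 (R : nat -> nat -> Prop) : rsym Lall 2 :=
  fun v => R (v ord0) (v ord_max).
Definition rs3 (R : nat -> nat -> nat -> Prop) : rsym Lall 3 :=
  fun v => R (v i30) (v i31) (v i32).

Section Values.
Variable M : structure Lall.

Definition num (k : nat) : M := fint M (k := 0) (fun=> k) noenv.
Definition fun1 f (a : M) : M := fint M (fs1 f) (tnth [tuple a]).
Definition fun2 f (a b : M) : M := fint M (fs2 f) (tnth [tuple a; b]).
Definition fun3 f (a b c : M) : M := fint M (fs3 f) (tnth [tuple a; b; c]).
Definition rel2 R (a b : M) : Prop := rint M (rs2 R) (tnth [tuple a; b]).
Definition rel3 R (a b c : M) : Prop := rint M (rs3 R) (tnth [tuple a; b; c]).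

Definition nonstandard (a : M) : Prop := forall k : nat, a <> num k.
Definition mlt : M -> M -> Prop := rel2 (fun x y => x < y).

End Values.

(* Codes are given by [pickle]; numbers that are not codes get default
   decodings, so that every number codes a finite set, a finite binary relation
   and a finite tree. *)
Definition fset_of (a : nat) : {fset nat} := odflt fset0 (choice.unpickle a).
Definition in_code (x a : nat) : Prop := x \in fset_of a.
Definition card_code (a : nat) : nat := #|` fset_of a|.

Definition edges_of (w : nat) : {fset nat * nat} := odflt fset0 (choice.unpickle w).
Definition edge (w x y : nat) : Prop := (x, y) \in edges_of w.

Definition neighbor (w x : nat) : nat :=
  head 0 [seq p.2 | p <- edges_of w & p.1 == x].

Definition fgraph_of k (f : {ffun 'I_k -> 'I_k./2}) : {fset nat * nat} :=
  [fset p in [seq (nat_of_ord i, nat_of_ord (f i)) | i : 'I_k]]%fset.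

(* An {E}-structure on {0,...,k-1} is coded by its relation [E]. *)
Definition sample_code (k : nat) : nat :=
  choice.pickle [fset w in
    [seq choice.pickle (fgraph_of f) | f : {ffun 'I_k -> 'I_k./2}]]%fset.

(* [GenTree.Leaf a] is a leaf labeled [a]; [GenTree.Node v ts] is a node labeled
   [v] whose edge labeled [u] leads to the root of the [u]-th tree of [ts]. *)
Definition ltree := GenTree.tree nat.

Definition tree_of (T : nat) : ltree := odflt (GenTree.Leaf 0) (choice.unpickle T).

Fixpoint wf_tree (k : nat) (T : ltree) : bool :=
  match T with
  | GenTree.Leaf _ => true
  | GenTree.Node v ts => [&& v < k, size ts == k & all (wf_tree k) ts]
  end.

Fixpoint depth_tree (T : ltree) : nat :=
  match T with
  | GenTree.Leaf _ => 0
  | GenTree.Node _ ts => (foldr maxn 0 (map depth_tree ts)).+1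
  end.

Fixpoint leaves (T : ltree) : seq nat :=
  match T with
  | GenTree.Leaf a => [:: a]
  | GenTree.Node _ ts => flatten (map leaves ts)
  end.

Fixpoint run_tree (nb : nat -> nat) (T : ltree) : nat :=
  match T with
  | GenTree.Leaf a => a
  | GenTree.Node v ts => nth 0 (map (run_tree nb) ts) (nb v)
  end.

Definition wf (k T : nat) : Prop := wf_tree k (tree_of T).
Definition depth (T : nat) : nat := depth_tree (tree_of T).
Definition leaf_label (T a : nat) : Prop := a \in leaves (tree_of T).
Definition output (T w : nat) : nat := run_tree (neighbor w) (tree_of T).

(* [d <= k^(1/t)] and [x <= 2^(k^(1/t))], with real exponents: as [d] and [x] are
   integers, this is the same as bounding them by the rounded-down right-hand
   sides. *)
Definition le_root (k t d : nat) : Prop :=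
  Rdefinitions.Rle (Raxioms.INR d)
    (Rpower.Rpower (Raxioms.INR k) (Rdefinitions.Rinv (Raxioms.INR t))).
Definition le_exp_root (k t x : nat) : Prop :=
  Rdefinitions.Rle (Raxioms.INR x)
    (Rpower.Rpower (Raxioms.INR 2)
      (Rpower.Rpower (Raxioms.INR k) (Rdefinitions.Rinv (Raxioms.INR t)))).

Section Transfer.
Variable M : structure Lall.
Hypothesis trueM : true_arithmetic M.

Lemma noenvE (T : Type) (e : 'I_0 -> T) : e = noenv.
Proof. by apply/funext => -[]. Qed.

Lemma sconsE (T : Type) m (e : 'I_m.+1 -> T) :
  scons (e ord0) (fun i => e (lift ord0 i)) = e.
Proof.
by apply/funext => i; rewrite /scons; case: unliftP => [j|] ->.
Qed.

Lemma transfer m (phi : formula Lall m) :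
  (forall e : 'I_m -> stdN, sat phi e) -> forall e : 'I_m -> M, sat phi e.
Proof.
elim: m phi => [|m IH] phi H e; first by rewrite (noenvE e); apply: trueM.
rewrite -(sconsE e); move: (e ord0); apply: (IH (FAll phi)) => e' a.
exact: H.
Qed.

Definition tf1 m f (a : term Lall m) := App (fs1 f) (tnth [tuple a]).
Definition tf2 m f (a b : term Lall m) := App (fs2 f) (tnth [tuple a; b]).
Definition tf3 m f (a b c : term Lall m) := App (fs3 f) (tnth [tuple a; b; c]).
Definition fr2 m R (a b : term Lall m) := FRel (rs2 R) (tnth [tuple a; b]).
Definition fr3 m R (a b c : term Lall m) :=
  FRel (rs3 R) (tnth [tuple a; b; c]).
Definition tnum m k : term Lall m := App (S := Lall) (k := 0) (fun=> k) noenv.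
Definition fimp m (A B : formula Lall m) := FOr (FNot A) B.

Section Eval.
Variables (N : structure Lall) (m : nat) (e : 'I_m -> N).
Notation ev := (teval (@fint Lall N) e).

Lemma tnth_comp T U k (f : T -> U) (t : k.-tuple T) (u : k.-tuple U) :
  map f t = u -> (fun i => f (tnth t i)) = tnth u.
Proof.
move=> E; apply/funext => i; have -> : u = map_tuple f t by exact: val_inj.
by rewrite tnth_map.
Qed.

Lemma evV i : ev (Var i) = e i. Proof. by []. Qed.

Lemma ev1 f a : ev (tf1 f a) = fun1 f (ev a).
Proof. by congr (fint _ _ _); apply: tnth_comp. Qed.

Lemma ev2 f a b : ev (tf2 f a b) = fun2 f (ev a) (ev b).
Proof. by congr (fint _ _ _); apply: tnth_comp. Qed.

Lemma ev3 f a b c : ev (tf3 f a b c) = fun3 f (ev a) (ev b) (ev c).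
Proof. by congr (fint _ _ _); apply: tnth_comp. Qed.

Lemma evn k : ev (tnum m k) = num N k.
Proof. by congr (fint _ _ _); apply: noenvE. Qed.

Lemma satE a b : sat (FEq a b) e = (ev a = ev b). Proof. by []. Qed.

Lemma sat2 R a b : sat (fr2 R a b) e = rel2 R (ev a) (ev b).
Proof. by congr (rint _ _ _); apply: tnth_comp. Qed.

Lemma sat3 R a b c : sat (fr3 R a b c) e = rel3 R (ev a) (ev b) (ev c).
Proof. by congr (rint _ _ _); apply: tnth_comp. Qed.

Lemma satN A : sat (FNot A) e = ~ sat A e. Proof. by []. Qed.
Lemma satA A B : sat (FAnd A B) e = (sat A e /\ sat B e). Proof. by []. Qed.
Lemma satO A B : sat (FOr A B) e = (sat A e \/ sat B e). Proof. by []. Qed.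
Lemma satI A B : sat (fimp A B) e = (sat A e -> sat B e).
Proof.
apply/propext; rewrite /= ; split; first by case.
by move=> H; have [/H|] := pselect (sat A e); [right|left].
Qed.
Lemma satall A : sat (FAll A) e = forall a, sat A (scons a e).
Proof. by []. Qed.

End Eval.

Definition evE := (evV, ev1, ev2, ev3, evn, satE, sat2, sat3, satN, satA, satO, satI).

End Transfer.

Section WideLimit.
Variable M : structure Lall.
Hypothesis trueM : true_arithmetic M.
Variable n : M.
Hypothesis nonstd_n : nonstandard n.

Definition Msample : M := fun1 sample_code n.

Definition sample := {w : M | rel2 in_code w Msample}.

Definition codes (a : M) (A : set sample) : Prop :=
  (forall x, rel2 in_code x a -> rel2 in_code x Msample) /\
  (forall w : sample, A w <-> rel2 in_code (sval w) a).

Definition coded (A : set sample) : bool := `[< exists a, codes a A >].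

Definition cset := {A : set sample | coded A}.

Definition code (A : cset) : M := sval (cid (asboolW (valP A))).

Lemma codeP (A : cset) : codes (code A) (val A).
Proof. by rewrite /code; case: cid. Qed.

(* [|A| / |sample| < 1/k] for all standard [k >= 1], without division. *)
Definition negligible (A : cset) : Prop :=
  forall k : nat, 0 < k ->
    mlt (fun2 muln (num M k) (fun1 card_code (code A))) (fun1 card_code Msample).

Notation v0 := (Var (S := Lall) (m := 4) (Ordinal (isT : 0 < 4))).
Notation v1 := (Var (S := Lall) (m := 4) (Ordinal (isT : 1 < 4))).
Notation v2 := (Var (S := Lall) (m := 4) (Ordinal (isT : 2 < 4))).
Notation v3 := (Var (S := Lall) (m := 4) (Ordinal (isT : 3 < 4))).

Definition sep (phi : formula Lall 4) (k a b : nat) : nat :=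
  choice.pickle [fset w in fset_of (sample_code k) |
          `[< sat phi (tnth [tuple k; a; b; w] : 'I_4 -> stdN) >]]%fset.

Lemma fset_ofK (s : {fset nat}) : fset_of (choice.pickle s) = s.
Proof. by rewrite /fset_of choice.pickleK. Qed.

Lemma sepE phi k a b w : in_code w (sep phi k a b) <->
  in_code w (sample_code k) /\
  sat phi (tnth [tuple k; a; b; w] : 'I_4 -> stdN).
Proof.
rewrite /in_code /sep fset_ofK !inE; split=> [/andP[wS /asboolP]|[wS H]] //.
by apply/andP; split=> //; apply/asboolP.
Qed.

Lemma separation (phi : formula Lall 4) (a b : M) :
  exists c, codes c
    [set w : sample | sat phi (tnth [tuple n; a; b; sval w] : 'I_4 -> M)].
Proof.
exists (fun3 (sep phi) n a b).
have H x : rel2 in_code x (fun3 (sep phi) n a b) <->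
    rel2 in_code x Msample /\ sat phi (tnth [tuple n; a; b; x] : 'I_4 -> M).
  pose L := fr2 in_code v3 (tf3 (sep phi) v0 v1 v2).
  pose R := FAnd (fr2 in_code v3 (tf1 sample_code v0)) phi.
  have /(transfer trueM) /(_ (tnth [tuple n; a; b; x])) :
      forall e : 'I_4 -> stdN, sat (FAnd (fimp L R) (fimp R L)) e.
    move=> e; rewrite /L /R !evE.
    have -> : sat phi e = sat phi
        (tnth [tuple e (Ordinal (isT : 0 < 4)); e (Ordinal (isT : 1 < 4));
          e (Ordinal (isT : 2 < 4)); e (Ordinal (isT : 3 < 4))] : 'I_4 -> stdN).
      congr sat; apply/funext => -[[|[|[|[|//]]]] ?] /=;
        rewrite /tnth /=; congr e; exact: val_inj.
    have H := sepE phi (e (Ordinal (isT : 0 < 4))) (e (Ordinal (isT : 1 < 4)))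
      (e (Ordinal (isT : 2 < 4))) (e (Ordinal (isT : 3 < 4))).
    by split; apply H.
  by rewrite /L /R !evE /tnth /= => -[].
split=> [x /H[]//|w]; rewrite H; split=> [|[]//].
by split=> //; exact: (svalP w).
Qed.

Lemma separable (phi : formula Lall 4) (a b : M) (A : set sample) :
  (forall w, A w <-> sat phi (tnth [tuple n; a; b; sval w] : 'I_4 -> M)) ->
  coded A.
Proof.
move=> H; apply/asboolP; have [c cP] := separation phi a b.
by exists c; split=> [|w]; [case: cP | rewrite H; case: cP => _ /(_ w)].
Qed.

Lemma coded0 : coded set0.
Proof.
apply: (@separable (FNot (FEq v0 v0)) n n) => w; rewrite !evE /=.
by split.
Qed.

Lemma codedC (A : cset) : coded (~` val A)%classic.
Proof.
apply: (@separable (FNot (fr2 in_code v3 v1)) (code A) (code A)) => w.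
by rewrite !evE; case: (codeP A) => _ /(_ w) /= ->.
Qed.

Lemma codedI (A B : cset) : coded (val A `&` val B)%classic.
Proof.
apply: (@separable (FAnd (fr2 in_code v3 v1) (fr2 in_code v3 v2)) (code A) (code B)).
move=> w; rewrite !evE.
by case: (codeP A) (codeP B) => _ /(_ w) /= <- [_ /(_ w) /= <-].
Qed.

Definition cset0 : cset := exist _ set0 coded0.
Definition csetC (A : cset) : cset := exist _ (~` val A)%classic (codedC A).
Definition csetI (A B : cset) : cset := exist _ (val A `&` val B)%classic (codedI A B).
Definition csetU A B := csetC (csetI (csetC A) (csetC B)).
Definition csetD A B := csetU (csetI A (csetC B)) (csetI B (csetC A)).

Lemma csetP (A B : cset) : (forall w, val A w <-> val B w) -> A = B.
Proof. by move=> H; apply/val_inj/seteqP; split=> w /H. Qed.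

Lemma csetUE A B w : val (csetU A B) w <-> val A w \/ val B w.
Proof.
rewrite /= /setC /setI /=; split=> [H|[a []//|b []//]].
by apply: contrapT => /not_orP H'; apply: H; case: H'.
Qed.

Lemma negl_sub (A B C : cset) : (forall w, val C w -> val A w \/ val B w) ->
  negligible A -> negligible B -> negligible C.
Proof.
move=> sub nA nB k k0.
have k20 : 0 < 2 * k by rewrite muln_gt0.
move: (nA _ k20) (nB _ k20).
have : forall x, rel2 in_code x (code C) ->
    rel2 in_code x (code A) \/ rel2 in_code x (code B).
  move=> x xC; have [sC eC] := codeP C.
  have /eC/sub := xC : rel2 in_code (sval (exist _ x (sC _ xC) : sample)) _.
  case: (codeP A) => _ eA; case: (codeP B) => _ eB.
  by case=> [/eA|/eB]; [left|right].
move: (code A) (code B) (code C) Msample => a b c o.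
pose w0 := Var (S := Lall) (m := 5) (Ordinal (isT : 0 < 5)).
pose w1 := Var (S := Lall) (m := 5) (Ordinal (isT : 1 < 5)).
pose w2 := Var (S := Lall) (m := 5) (Ordinal (isT : 2 < 5)).
pose w3 := Var (S := Lall) (m := 5) (Ordinal (isT : 3 < 5)).
pose lt := fun x y => (x < y : Prop).
pose small j (x : term Lall 4) :=
  fr2 lt (tf2 muln (tnum 4 j) (tf1 card_code x)) (tf1 card_code v3).
pose phi := fimp
  (FAll (fimp (fr2 in_code w0 w3) (FOr (fr2 in_code w0 w1) (fr2 in_code w0 w2))))
  (fimp (small (2 * k) v0) (fimp (small (2 * k) v1) (small k v2))).
have /(transfer trueM) /(_ (tnth [tuple a; b; c; o])) :
    forall e : 'I_4 -> stdN, sat phi e.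
  move=> e; rewrite /phi /small !evE satall.
  have S i x : scons x e (lift ord0 i) = e i by rewrite /scons liftK.
  have V x : [/\ teval (@fint _ stdN) (scons x e) w0 = x,
     teval (@fint _ stdN) (scons x e) w1 = e (Ordinal (isT : 0 < 4)),
     teval (@fint _ stdN) (scons x e) w2 = e (Ordinal (isT : 1 < 4)) &
     teval (@fint _ stdN) (scons x e) w3 = e (Ordinal (isT : 2 < 4))].
    split=> /=; first by rewrite /scons; case: unliftP => // j /(congr1 val).
    - by rewrite -(S _ x); congr scons; apply/val_inj.
    - by rewrite -(S _ x); congr scons; apply/val_inj.
    - by rewrite -(S _ x); congr scons; apply/val_inj.
  move=> H1.
  have {}H1 x : in_code x (e (Ordinal (isT : 2 < 4))) ->
      in_code x (e (Ordinal (isT : 0 < 4))) \/ in_code x (e (Ordinal (isT : 1 < 4))).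
    by move: (H1 x); rewrite satI satO !sat2; case: (V x) => -> -> -> ->.
  rewrite /rel2 /fun2 /fun1 /num /rs2 /fs2 /fs1 /= /tnth /= /lt.
  move: H1; set a' := e (Ordinal (isT : 0 < 4)).
  set b' := e (Ordinal (isT : 1 < 4)); set c' := e (Ordinal (isT : 2 < 4)).
  set o' := e (Ordinal (isT : 3 < 4)) => H1 ha hb.
  have : card_code c' <= card_code a' + card_code b'.
    apply: (@leq_trans #|` (fset_of a' `|` fset_of b')%fset|).
      by apply: fsubset_leq_card; apply/fsubsetP => x /H1 ?; apply/fsetUP.
    by rewrite cardfsU leq_subr.
  move=> H; apply: (@leq_ltn_trans (k * (card_code a' + card_code b'))).
    by rewrite leq_mul2l H orbT.
  rewrite -(ltn_pmul2l (m := 2)) // mulnA mulnDr mul2n -addnn.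
  rewrite [2 * card_code o']mul2n -[X in _ < X]addnn addnn -mul2n.
  by rewrite -addSn leq_add // ltnW.
rewrite /phi /small !evE satall => H sub'; apply: H => x.
have S i : scons x (tnth [tuple a; b; c; o]) (lift ord0 i) =
    tnth [tuple a; b; c; o] i by rewrite /scons liftK.
move: (sub' x); rewrite satI satO !sat2 /w0 /w1 /w2 /w3 !evV.
have -> : Ordinal (isT : 0 < 5) = ord0 by apply/val_inj.
have -> : Ordinal (isT : 1 < 5) = lift ord0 (Ordinal (isT : 0 < 4)).
  exact/val_inj.
have -> : Ordinal (isT : 2 < 5) = lift ord0 (Ordinal (isT : 1 < 4)).
  exact/val_inj.
have -> : Ordinal (isT : 3 < 5) = lift ord0 (Ordinal (isT : 2 < 4)).
  exact/val_inj.
by rewrite !S /scons; case: unliftP => // j /(congr1 val).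
Qed.

Lemma sample_gt0 k : k <> 1 -> 0 < card_code (sample_code k).
Proof.
move=> k1; rewrite /card_code /sample_code fset_ofK cardfs_gt0; apply/fset0Pn.
suff [f _] : exists f : {ffun 'I_k -> 'I_k./2}, True.
  by exists (choice.pickle (fgraph_of f)); rewrite !inE; apply/mapP; exists f; rewrite ?mem_enum.
case: k k1 => [|[|k]] // _; last by exists [ffun=> ord0].
by exists [ffun i => i].
Qed.

Lemma negl0 : negligible cset0.
Proof.
move=> k k0; have : n <> num M 1 by exact: nonstd_n.
have : forall x, ~ rel2 in_code x (code cset0).
  move=> x x0; have [sC eC] := codeP cset0.
  by case: ((eC (exist _ x (sC _ x0) : sample)).2 x0).
rewrite /Msample; move: (code cset0) => c.
pose w0 := Var (S := Lall) (m := 3) (Ordinal (isT : 0 < 3)).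
pose w1 := Var (S := Lall) (m := 3) (Ordinal (isT : 1 < 3)).
pose u0 := Var (S := Lall) (m := 2) (Ordinal (isT : 0 < 2)).
pose u1 := Var (S := Lall) (m := 2) (Ordinal (isT : 1 < 2)).
pose phi := fimp (FAll (FNot (fr2 in_code w0 w1)))
  (fimp (FNot (FEq u1 (tnum 2 1)))
    (fr2 (fun x y => x < y) (tf2 muln (tnum 2 k) (tf1 card_code u0))
       (tf1 card_code (tf1 sample_code u1)))).
have V (N : structure Lall) (e : 'I_2 -> N) x :
    [/\ teval (@fint _ N) (scons x e) w0 = x &
       teval (@fint _ N) (scons x e) w1 = e (Ordinal (isT : 0 < 2))].
  split=> /=; first by rewrite /scons; case: unliftP => // j /(congr1 val).
  have <- : scons x e (lift ord0 (Ordinal (isT : 0 < 2))) = e (Ordinal (isT : 0 < 2)).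
    by rewrite /scons liftK.
  by congr scons; apply/val_inj.
have /(transfer trueM) /(_ (tnth [tuple c; n])) :
    forall e : 'I_2 -> stdN, sat phi e.
  move=> e; rewrite /phi !evE satall => H1 e1.
  have {}H1 x : ~ in_code x (e (Ordinal (isT : 0 < 2))).
    by move: (H1 x); rewrite satN sat2; case: (V _ e x) => -> ->.
  rewrite /rel2 /fun2 /fun1 /num /rs2 /fs2 /fs1 /= /tnth /=.
  have -> : card_code (e (Ordinal (isT : 0 < 2))) = 0.
    apply/eqP; rewrite cardfs_eq0; apply/eqP/fsetP => x.
    by rewrite inE; apply/negbTE/negP/H1.
  by rewrite muln0; apply: sample_gt0.
rewrite /phi !evE satall => H H1; apply: H => x.
by move: (H1 x); rewrite satN sat2; case: (V _ (tnth [tuple c; n]) x) => -> ->.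
Qed.

Lemma csetDE A B w : val (csetD A B) w <->
  (val A w /\ ~ val B w) \/ (val B w /\ ~ val A w).
Proof. exact: csetUE. Qed.

Lemma negl_csetD (A A' B B' C C' : cset) :
  (forall w, (val A w <-> val A' w) -> (val B w <-> val B' w) ->
     (val C w <-> val C' w)) ->
  negligible (csetD A A') -> negligible (csetD B B') ->
  negligible (csetD C C').
Proof.
move=> H; apply: negl_sub => w; rewrite !csetDE.
by have := H w; have := pselect (val A w); have := pselect (val A' w);
   have := pselect (val B w); have := pselect (val B' w); tauto.
Qed.

Definition ae_eq (A B : cset) : bool := `[< negligible (csetD A B) >].

Lemma ae_eq_refl : reflexive ae_eq.
Proof.
move=> A; apply/asboolP; rewrite (_ : csetD A A = cset0); first exact: negl0.
by apply: csetP => w; rewrite csetDE /=; tauto.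
Qed.

Lemma ae_eq_sym : symmetric ae_eq.
Proof.
move=> A B; rewrite /ae_eq (_ : csetD A B = csetD B A) //.
by apply: csetP => w; rewrite !csetDE; tauto.
Qed.

Lemma ae_eq_trans : transitive ae_eq.
Proof.
move=> B A C /asboolP AB /asboolP BC; apply/asboolP.
by apply: negl_csetD AB BC => w; tauto.
Qed.

Canonical ae_equiv := EquivRel ae_eq ae_eq_refl ae_eq_sym ae_eq_trans.

Definition balg := {eq_quot ae_eq}.
HB.instance Definition _ := Choice.on balg.

Definition bclass (A : cset) : balg := \pi_{eq_quot ae_eq} A.

Lemma bclassP A B : negligible (csetD A B) -> bclass A = bclass B.
Proof. by move=> H; apply/(@eqmodP _ ae_equiv)/asboolP. Qed.

Lemma bclass_repr (x : balg) : x = bclass (repr (x : {eq_quot ae_eq})).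
Proof. by rewrite /bclass reprK. Qed.

Lemma repr_bclass A : negligible (csetD (repr (bclass A : {eq_quot ae_eq})) A).
Proof.
by apply/asboolP; apply/(@eqmodP _ ae_equiv); rewrite reprK.
Qed.

Definition bmeet (x y : balg) : balg :=
  bclass (csetI (repr (x : {eq_quot ae_eq})) (repr (y : {eq_quot ae_eq}))).
Definition bjoin (x y : balg) : balg :=
  bclass (csetU (repr (x : {eq_quot ae_eq})) (repr (y : {eq_quot ae_eq}))).
Definition bcompl (x : balg) : balg :=
  bclass (csetC (repr (x : {eq_quot ae_eq}))).

Lemma bclassI A B : bmeet (bclass A) (bclass B) = bclass (csetI A B).
Proof.
apply: bclassP; apply: negl_csetD (repr_bclass A) (repr_bclass B) => w.
by rewrite /= /setI /=; tauto.
Qed.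

Lemma bclassU A B : bjoin (bclass A) (bclass B) = bclass (csetU A B).
Proof.
apply: bclassP; apply: negl_csetD (repr_bclass A) (repr_bclass B) => w.
by rewrite !csetUE; tauto.
Qed.

Lemma bclassC A : bcompl (bclass A) = bclass (csetC A).
Proof.
apply: bclassP; apply: negl_csetD (repr_bclass A) (repr_bclass A) => w.
by rewrite /= /setC /=; tauto.
Qed.

Ltac bool_law :=
  repeat (let x := fresh "x" in move=> x; rewrite (bclass_repr x);
    move: (repr (x : {eq_quot ae_eq})) => {}x);
  rewrite ?(bclassI, bclassU, bclassC); congr bclass; apply: csetP;
  let w := fresh "w" in move=> w;
  rewrite ?csetUE /= /setI /setC /= ?csetUE /=;
  repeat match goal with x : cset |- _ =>
    move: (pselect (val x w)); move: (val x w) => ?; clear x end; tauto.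

Lemma bmeetC : commutative bmeet. Proof. bool_law. Qed.
Lemma bjoinC : commutative bjoin. Proof. bool_law. Qed.
Lemma bmeetA : associative bmeet. Proof. bool_law. Qed.
Lemma bjoinA : associative bjoin. Proof. bool_law. Qed.
Lemma bjoinKI y x : bmeet x (bjoin x y) = x. Proof. move: y x; bool_law. Qed.
Lemma bmeetKU y x : bjoin x (bmeet x y) = x. Proof. move: y x; bool_law. Qed.
Lemma bmeetUl : left_distributive bmeet bjoin. Proof. bool_law. Qed.
Lemma bmeetxx : idempotent_op bmeet. Proof. bool_law. Qed.

Fact balg_display : Order.disp_t. Proof. exact: Order.Disp tt tt. Qed.

HB.instance Definition _ := @Order.isMeetJoinDistrLattice.Build balg_display
  balg (fun x y => bmeet x y == x) (fun x y => (y != x) && (bmeet x y == x))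
  bmeet bjoin (fun _ _ => erefl) (fun _ _ => erefl) bmeetC bjoinC bmeetA bjoinA
  bjoinKI bmeetKU bmeetUl bmeetxx.

Lemma bbot_le (x : balg) : (bclass cset0 <= x)%O.
Proof. by apply/eqP; move: x; bool_law. Qed.
Lemma btop_ge (x : balg) : (x <= bclass (csetC cset0))%O.
Proof. by apply/eqP; move: x; bool_law. Qed.

HB.instance Definition _ := @Order.hasBottom.Build balg_display balg
  (bclass cset0) bbot_le.
HB.instance Definition _ := @Order.hasTop.Build balg_display balg
  (bclass (csetC cset0)) btop_ge.

Lemma bcomplI (x : balg) : bmeet x (bcompl x) = bclass cset0.
Proof. move: x; bool_law. Qed.
Lemma bcomplU (x : balg) : bjoin x (bcompl x) = bclass (csetC cset0).
Proof. move: x; bool_law. Qed.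


HB.instance Definition _ :=
  @Order.TBDistrLattice_hasComplement.Build balg_display balg
    bcompl bcomplU bcomplI.

Definition quot_class (A : set sample) (cA : coded A) : balg :=
  bclass (exist _ A cA).

Definition in_Mn (x : M) : Prop :=
  exists2 t, nonstandard t & rel3 le_exp_root n t x.

Definition Tnb (T : M) : Prop :=
  [/\ rel2 wf n T,
      forall a, rel2 leaf_label T a -> in_Mn a &
      exists2 t, nonstandard t & rel3 le_root n t (fun1 depth T)].

Definition computes (T : M) (alpha : sample -> M) : Prop :=
  forall w : sample, alpha w = fun2 output T (sval w).

Definition Fnb (alpha : sample -> M) : Prop :=
  exists2 T, Tnb T & computes T alpha.

Definition universe :=
  {alpha : sample -> M | Fnb alpha /\ forall w, mlt (alpha w) n}.

Lemma coded_eq (a b : universe) : coded [set w | sval a w = sval b w].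
Proof.
case: a b => [a [[S _ Sa] _]] [b [[T _ Tb] _]] /=.
apply: (@separable (FEq (tf2 output v1 v3) (tf2 output v2 v3)) S T) => w.
by rewrite !evE /= Sa Tb.
Qed.

Lemma coded_edge (a b : universe) :
  coded [set w | rel3 edge (sval w) (sval a w) (sval b w)].
Proof.
case: a b => [a [[S _ Sa] _]] [b [[T _ Tb] _]] /=.
apply: (@separable (fr3 edge v3 (tf2 output v1 v3) (tf2 output v2 v3)) S T).
by move=> w; rewrite !evE /= Sa Tb.
Qed.

Definition limit : bstructure graph_sig balg :=
  @BStructure graph_sig balg_display balg universe
    (fun k (f : fsym graph_sig k) => match f with end)
    (fun a b => quot_class (coded_eq a b))
    (fun k (r : rsym graph_sig k) => match r with
       | Edge => fun v => quot_class (coded_edge (v ord0) (v ord_max)) end).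

End WideLimit.

(* (exists x)(exists y)(exists z) (x <> y /\ E(x,z) /\ E(y,z)) *)
Definition collision : formula graph_sig 0 :=
  let x : term graph_sig 3 := Var i32 in
  let y : term graph_sig 3 := Var i31 in
  let z : term graph_sig 3 := Var i30 in
  let E s t : formula graph_sig 3 :=
    FRel (Edge : rsym graph_sig 2) (tnth [tuple s; t]) in
  FEx (FEx (FEx (FAnd (FNot (FEq x y)) (FAnd (E x z) (E y z))))).

(* Main.v *)
From Stdlib Require Import Reals.
Require Import Defs.
From mathcomp Require Import all_boot all_order finmap.
From mathcomp Require Import boolp.
From mathcomp Require Import zify.

(** The existential quantifiers are suprema, so it suffices that for all
    [alpha], [beta], [gamma] in the universe the event

      alpha <> beta,  E(alpha, gamma),  E(beta, gamma)

    has infinitesimal probability.  On this event the random function [omega]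
    takes the same value at the two distinct points [alpha(omega)] and
    [beta(omega)], which are found by two trees of depth at most [d], where
    [d ^ 3 <= n].  Running the trees and then querying their outputs is an
    adaptive procedure that makes [q = 2 d + 2] queries and exposes a
    collision of a uniformly random function into a set of size
    [h = floor(n / 2)]; a birthday bound shows that this has probability at most
    [q ^ 2 / h], which is below every [1 / c] once [n] is large.

    The birthday bound ([collisions_encoded]) is proved by an encoding instead
    of a union bound over times.  If [f] has a collision, let [j] be the time
    at which its second point is queried first and [i < j] the time at which
    its other point is queried first.  Changing the value of [f] at the [j]-th
    query to an arbitrary [u] gives a function [g] for which the first [j + 1]
    queries are the same, because the earlier answers did not change; so [f]
    and [u] are recovered from [g], [i] and [j]: the [j]-th query of [g] has
    [g]-value [u], and its [f]-value is the [g]-value of the [i]-th query.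
    Hence there are at most [N q ^ 2] pairs [(f, u)], where [N] counts all
    functions, while every bad [f] occurs in [h] of them.

    For natural numbers this is [few_collisions].  It passes to the nonstandard
    model as a quantifier-free formula ([few_collisions_nonstandard]): the only
    inner quantifier, over the elements of a coded set of samples, is removed
    by a Skolem function ([stray]), which has a name in the language. *)

Set Implicit Arguments.
Unset Strict Implicit.
Unset Printing Implicit Defensive.

(** * Adaptive queries to a random function *)

(** A querying procedure is a state machine: in state [s] it queries [query s]
    and moves to [step s u] on answer [u]. *)
Section Encoding.
Variables (k h : nat) (X : Type) (query : X -> nat) (step : X -> nat -> X).
Variable x0 : X.
Implicit Types f g : {ffun 'I_k.+1 -> 'I_h}.

(** The default value [0] off the domain agrees with that of [neighbor]. *)
Definition answer f (x : nat) : nat := oapp (fun i => f i : nat) 0 (insub x).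

Definition state f j : X :=
  iter j (fun s => step s (answer f (query s))) x0.
Definition probe f j : nat := query (state f j).

Definition update f (y : 'I_k.+1) (u : 'I_h) : {ffun 'I_k.+1 -> 'I_h} :=
  [ffun x => if x == y then u else f x].

Lemma answerE f (i : 'I_k.+1) : answer f i = f i.
Proof. by rewrite /answer valK. Qed.

Lemma answer_update f (y : 'I_k.+1) u (x : nat) :
  x != y -> answer (update f y u) x = answer f x.
Proof.
rewrite /answer; case: insubP => //= i _ <- /negPf ne.
by rewrite ffunE -val_eqE /= ne.
Qed.

Lemma eq_state f g j :
  (forall i, i < j -> answer f (probe f i) = answer g (probe f i)) ->
  state f j = state g j.
Proof.
elim: j => //= j IH H; rewrite -IH => [|i /ltnW]; last exact: H.
by rewrite -[answer g _]H.
Qed.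

(** The map [decode] below undoes the resampling of the later point of a
    collision; its image contains [D x 'I_h]. *)
Lemma collisions_encoded q (D : {set {ffun 'I_k.+1 -> 'I_h}}) :
  (forall f, f \in D -> exists x y : 'I_k.+1,
     [/\ x != y, f x = f y, exists2 i, i < q & probe f i = x &
         exists2 j, j < q & probe f j = y]) ->
  #|D| * h <= #|{ffun 'I_k.+1 -> 'I_h}| * (q * q).
Proof.
move=> DP.
pose decode (p : {ffun 'I_k.+1 -> 'I_h} * ('I_q * 'I_q)) :=
  let: (g, (i, j)) := p in
  let x : 'I_k.+1 := inord (probe g i) in
  let y : 'I_k.+1 := inord (probe g j) in (update g y (g x), g y).
suff sub : setX D [set: 'I_h] \subset decode @: setT.
  have := leq_trans (subset_leq_card sub) (leq_imset_card _ _).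
  by rewrite cardsX !cardsT !card_prod !card_ord.
apply/subsetP => -[f u] /setXP[/DP fD _].
have [x [y [ne_xy eq_f [a lt_a Pa] [b lt_b Pb]]]] := fD.
(* The times of first visit of the two points differ; the later one is [j]. *)
have [i [j [lt_ij [lt_jq [v Pj [new_j [w Pi {}eq_f]]]]]]] :
    exists i j, i < j /\ j < q /\ exists2 y : 'I_k.+1, probe f j = y &
    (forall l, l < j -> probe f l != y) /\
    exists2 x : 'I_k.+1, probe f i = x & f x = f y.
  have first (z : 'I_k.+1) c : c < q -> probe f c = z -> exists i,
      [/\ i < q, probe f i = z & forall l, l < i -> probe f l != z].
    move=> lt_c Pc; have ex : exists i, probe f i == z by exists c; apply/eqP.
    case: (ex_minnP ex) => i /eqP Pi min_i; exists i; split=> // [|l lt_li].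
      by apply: leq_ltn_trans lt_c; apply/min_i/eqP.
    by apply: contraL lt_li => /min_i; rewrite leqNgt.
  have [i [lt_i Pi new_i]] := first x a lt_a Pa.
  have [j [lt_j Pj new_j]] := first y b lt_b Pb.
  have [lt_ij|lt_ji|eq_ij] := ltngtP i j.
  - by exists i, j; do !split=> //; exists y => //; split=> //; exists x.
  - by exists j, i; do !split=> //; exists x => //; split=> //; exists y.
  - by case/eqP: ne_xy; apply: val_inj; rewrite /= -Pi eq_ij.
set g := update f v u.
have eq_probe l : l <= j -> probe g l = probe f l.
  move=> le_lj; rewrite /probe; congr query; symmetry.
  apply: eq_state => m lt_m.
  by rewrite answer_update ?new_j // (leq_trans lt_m).
have lt_iq := ltn_trans lt_ij lt_jq.
apply/imsetP; exists (g, (Ordinal lt_iq, Ordinal lt_jq)) => //=.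
rewrite !eq_probe ?(ltnW lt_ij) // Pi Pj !inord_val.
have -> : g v = u by rewrite ffunE eqxx.
have ne_wv : w != v by rewrite -val_eqE /= -Pi new_j.
have -> : g w = f w by rewrite ffunE (negPf ne_wv).
congr pair; apply/ffunP => z; rewrite !ffunE eq_f.
by case: (z =P v) => [->|].
Qed.
End Encoding.

(** * Running two decision trees *)

Definition root_label (T : ltree) : nat :=
  match T with GenTree.Leaf a => a | GenTree.Node v _ => v end.

Definition child (T : ltree) (u : nat) : ltree :=
  match T with
  | GenTree.Leaf a => GenTree.Leaf a
  | GenTree.Node _ ts => nth (GenTree.Leaf 0) ts u
  end.

(** Leaves are fixed by [child], so that the number of steps can be padded and
    trees of different depths can be run for the same time. *)
Definition descend (nb : nat -> nat) j (T : ltree) : ltree :=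
  iter j (fun A => child A (nb (root_label A))) T.

(** Where a branch is missing, [child] gives a leaf labeled [0], and the output
    of [run_tree] is [0] too; this makes the two agree on every tree. *)
Lemma descend_output nb j T :
  depth_tree T <= j -> descend nb j T = GenTree.Leaf (run_tree nb T).
Proof.
rewrite /descend; elim: j T => [|j IH] [a|v ts] //.
  by move=> _; rewrite iterS IH.
rewrite ltnS iterSr /= => le_j; rewrite IH.
  have [lt_u|le_u] := ltnP (nb v) (size ts).
    by rewrite (nth_map (GenTree.Leaf 0)).
  by rewrite !nth_default ?size_map.
apply: leq_trans le_j; elim: ts (nb v) => [|A ts IHts] [|u] //=.
  by rewrite leq_maxl.
by apply: leq_trans (IHts u) _; rewrite leq_maxr.
Qed.

(** Two trees are run in turns: the first one of the pair makes a step, and the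
    trees change places.  As the label of a leaf is queried too, after [d]
    rounds the next two queries are the outputs of the two trees. *)
Definition turn (p : ltree * ltree) (u : nat) := (p.2, child p.1 u).
Definition asked (p : ltree * ltree) : nat := root_label p.1.

Lemma state_turns k h (f : {ffun 'I_k.+1 -> 'I_h}) S T j :
  state asked turn (S, T) f j.*2 =
    (descend (answer f) j S, descend (answer f) j T) /\
  state asked turn (S, T) f j.*2.+1 =
    (descend (answer f) j T, descend (answer f) j.+1 S).
Proof.
elim: j => // j [_ IH].
have E : state asked turn (S, T) f j.+1.*2 =
    (descend (answer f) j.+1 S, descend (answer f) j.+1 T).
  by rewrite doubleS /state iterS -/(state _ _ _ _ _) IH.
by split=> //; rewrite /state iterS -/(state _ _ _ _ _) E.
Qed.

Definition colliding k h (S T : ltree) (f : {ffun 'I_k.+1 -> 'I_h}) : bool :=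
  [exists x, exists y, [&& x != y, f x == f y,
     run_tree (answer f) S == x & run_tree (answer f) T == y]].

Lemma card_colliding k h S T d : depth_tree S <= d -> depth_tree T <= d ->
  #|[set f : {ffun 'I_k.+1 -> 'I_h} | colliding S T f]| * h <=
  #|{ffun 'I_k.+1 -> 'I_h}| * (d.*2.+2 * d.*2.+2).
Proof.
move=> dS dT; apply: (@collisions_encoded _ _ _ asked turn (S, T)) => f.
rewrite inE => /existsP[x /existsP[y /and4P[ne /eqP eqf /eqP xE /eqP yE]]].
have [E0 E1] := state_turns f S T d.
exists x, y; split=> //.
  by exists d.*2; [rewrite ltnS | rewrite /probe E0 /asked descend_output].
by exists d.*2.+1; [rewrite ltnS | rewrite /probe E1 /asked descend_output].
Qed.

(** If [d] is below [32 c + 2], then [c (2 d + 2) ^ 2 < k / 2] by the size of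
    [k]; otherwise it follows from [k >= d ^ 3 >= (32 c + 2) d ^ 2]. *)
Definition threshold c := 8 * c * (32 * c + 2) ^ 2 + 4.

Lemma collision_arith c k d N b : threshold c <= k -> d ^ 3 <= k ->
  0 < N -> b * k./2 <= N * (d.*2.+2 * d.*2.+2) -> c * b < N.
Proof.
rewrite /threshold => large small N0 enc.
have few : c * (d.*2.+2 * d.*2.+2) < k./2.
  have [ge_d|lt_d] := leqP (32 * c + 2) d; last by nia.
  have : 32 * c * d ^ 2 + 2 * d ^ 2 <= d ^ 3.
    by rewrite -mulnDl expnS leq_mul2r ge_d orbT.
  by nia.
have h0 : 0 < k./2 by apply: leq_ltn_trans few.
rewrite -(ltn_pmul2r h0) -mulnA.
apply: leq_ltn_trans (_ : c * (N * (d.*2.+2 * d.*2.+2)) < _).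
  by rewrite leq_mul2l enc orbT.
by rewrite mulnCA ltn_pmul2l.
Qed.

(** * Counting codes of samples *)

Definition sample_point k (f : {ffun 'I_k -> 'I_k./2}) : nat :=
  choice.pickle (fgraph_of f).

Lemma edge_sample_point k (f : {ffun 'I_k -> 'I_k./2}) x y :
  edge (sample_point f) x y <-> exists2 i : 'I_k, x = i & y = f i.
Proof.
rewrite /edge /edges_of /sample_point choice.pickleK /= !inE.
split=> [/mapP[i _ [-> ->]]|[i -> ->]]; first by exists i.
by apply/mapP; exists i; rewrite ?mem_enum.
Qed.

Lemma sample_point_inj k : injective (@sample_point k).
Proof.
move=> f g eq_fg; apply/ffunP => i; apply: val_inj.
have : edge (sample_point g) i (f i).
  by rewrite -eq_fg; apply/edge_sample_point; exists i.
by case/edge_sample_point => j /val_inj <-.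
Qed.

Lemma neighbor_sample_point k (f : {ffun 'I_k.+1 -> 'I_k.+1./2}) :
  neighbor (sample_point f) = answer f.
Proof.
apply/funext => x; rewrite /neighbor.
set s := [seq p <- _ | _].
have sE p : p \in s -> p.1 = x /\ edge (sample_point f) p.1 p.2.
  by rewrite mem_filter /edge -surjective_pairing => /andP[/eqP].
have s_answer p : p \in s -> p.2 = answer f x.
  by case/sE=> <- /edge_sample_point[i -> ->]; rewrite answerE.
have s_nil : s = [::] -> answer f x = 0.
  move=> s0; rewrite /answer; case: insubP => //= i _ xE.
  suff : (x, nat_of_ord (f i)) \in s by rewrite s0.
  by rewrite mem_filter eqxx; apply/edge_sample_point; exists i.
case: s s_answer s_nil {sE} => [_ -> //|p s' s_answer _] /=.
by rewrite s_answer ?mem_head.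
Qed.

Lemma card_sample k :
  card_code (sample_code k) = #|{ffun 'I_k -> 'I_k./2}|.
Proof.
rewrite /card_code /sample_code fset_ofK card_fseq undup_id.
  by rewrite size_map -cardE.
by rewrite map_inj_uniq ?enum_uniq //; apply: sample_point_inj.
Qed.

Lemma in_sampleP k w :
  in_code w (sample_code k) <->
  exists f : {ffun 'I_k -> 'I_k./2}, w = sample_point f.
Proof.
rewrite /in_code /sample_code fset_ofK inE.
split=> [/mapP[f _ ->]|[f ->]]; first by exists f.
by apply/mapP; exists f; rewrite ?mem_enum.
Qed.

Definition collides (k S T R w : nat) : Prop :=
  [/\ in_code w (sample_code k), output S w <> output T w,
      edge w (output S w) (output R w) & edge w (output T w) (output R w)].

Lemma few_collisions c k S T R C : threshold c <= k ->
  depth S ^ 3 <= k -> depth T ^ 3 <= k ->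
  (forall w, in_code w C -> collides k S T R w) ->
  c * card_code C < card_code (sample_code k).
Proof.
case: k => [|k] large; first by rewrite /threshold addnC in large.
move=> dS dT CP; rewrite card_sample.
pose D := finset (@colliding k k.+1./2 (tree_of S) (tree_of T)).
pose d := maxn (depth S) (depth T).
have small : d ^ 3 <= k.+1 by rewrite /d; case: (leqP (depth S)).
have N0 : 0 < #|{ffun 'I_k.+1 -> 'I_k.+1./2}|.
  rewrite -card_sample; apply: sample_gt0 => k1.
  by move: large; rewrite k1 /threshold; lia.
have enc : #|D| * k.+1./2 <=
    #|{ffun 'I_k.+1 -> 'I_k.+1./2}| * (d.*2.+2 * d.*2.+2).
  by apply: card_colliding; rewrite /d ?leq_maxl ?leq_maxr.
apply: leq_ltn_trans (collision_arith large small N0 enc).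
rewrite leq_mul2l; apply/orP; right.
rewrite cardE -(size_map (@sample_point k.+1)).
apply: uniq_leq_size => [|w /CP[/in_sampleP[f ->]]]; first exact: fset_uniq.
rewrite /output neighbor_sample_point => ne.
move=> /edge_sample_point[x xE zE] /edge_sample_point[y yE zE'].
apply: map_f; rewrite mem_enum inE.
apply/existsP; exists x; apply/existsP; exists y.
rewrite xE yE !eqxx -!val_eqE /= -zE -zE' eqxx !andbT -xE -yE.
exact/eqP.
Qed.

(** The exponent [3] is the least integer that makes the square of the number of
    queries negligible against [k]. *)
Lemma cube_of_le_root k t d : 0 < k -> 3 <= t -> le_root k t d -> d ^ 3 <= k.
Proof.
move=> k0 t3; case: d => [|d]; first by [].
rewrite /le_root => le_d; apply/leP/INR_le.
have INR_gt0 m : 0 < m -> Rlt (INR 0) (INR m) by move=> /ltP/lt_INR.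
have INR_ge m p : p <= m -> Rle (INR p) (INR m) by move=> /leP/le_INR.
have -> : INR (d.+1 ^ 3) = pow (INR d.+1) 3.
  by rewrite !expnS expn0 !mult_INR /= ?Rmult_1_r.
apply: Rle_trans (pow_incr _ _ 3 (conj (INR_ge d.+1 0 isT) le_d)) _.
rewrite -Rpower_pow; last by apply: exp_pos.
rewrite Rpower_mult -[X in Rle _ X](Rpower_1 (INR k)); last exact: INR_gt0.
apply: Rle_Rpower; first exact: (INR_ge k 1).
have t_gt0 := INR_gt0 t (leq_trans (isT : 0 < 3) t3).
apply: (Rmult_le_reg_l (INR t)) => //.
rewrite -Rmult_assoc Rinv_r ?Rmult_1_l ?Rmult_1_r; first exact: INR_ge.
exact: Rgt_not_eq.
Qed.

(** * Transfer to the nonstandard model *)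

From mathcomp Require Import classical_sets.
Import Order.TTheory.

Definition le_nat (x y : nat) : Prop := x <= y.
Definition lt_nat (x y : nat) : Prop := x < y.
Definition cube_le (k d : nat) : Prop := d ^ 3 <= k.

Section Nonstandard.
Variable M : structure Lall.
Hypothesis trueM : true_arithmetic M.

Lemma nonstandard_ge (a : M) N : nonstandard a -> rel2 le_nat (num M N) a.
Proof.
move=> a_nonstd; pose v : term Lall 1 := Var ord0.
have tnth_a : tnth [tuple a] ord0 = a by [].
elim: N => [|N IH].
  pose phi := fr2 le_nat (tnum 1 0) v.
  have : forall e : 'I_1 -> stdN, sat phi e by move=> e; rewrite /phi !evE.
  by move=> /(transfer trueM)/(_ (tnth [tuple a])); rewrite /phi !evE.
pose phi := fimp (fr2 le_nat (tnum 1 N) v)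
  (FOr (FEq v (tnum 1 N)) (fr2 le_nat (tnum 1 N.+1) v)).
have : forall e : 'I_1 -> stdN, sat phi e.
  move=> e; rewrite /phi !evE => le_N.
  have [lt_N|] := ltnP N (e ord0); first by right.
  by move=> ge_N; left; apply/eqP; rewrite eqn_leq ge_N.
move=> /(transfer trueM)/(_ (tnth [tuple a])).
by rewrite /phi !evE tnth_a => /(_ IH)[/a_nonstd|].
Qed.

Lemma root_cube_le (n t d : M) : nonstandard n -> nonstandard t ->
  rel3 le_root n t d -> rel2 cube_le n d.
Proof.
move=> /(@nonstandard_ge _ 1) n1 /(@nonstandard_ge _ 3) t3.
pose vn : term Lall 3 := Var i30; pose vt : term Lall 3 := Var i31.
pose vd : term Lall 3 := Var i32.
pose phi := fimp (fr2 le_nat (tnum 3 1) vn) (fimp (fr2 le_nat (tnum 3 3) vt)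
  (fimp (fr3 le_root vn vt vd) (fr2 cube_le vn vd))).
have : forall e : 'I_3 -> stdN, sat phi e.
  by move=> e; rewrite /phi !evE; apply: cube_of_le_root.
move=> /(transfer trueM)/(_ (tnth [tuple n; t; d])).
by rewrite /phi !evE; apply.
Qed.

Notation v i := (Var (S := Lall) (m := 5) (Ordinal (isT : i < 5))).
Notation o i := (Ordinal (isT : i < 5)).

(** An element of the set coded by the last argument at which [collides] fails
    for the other arguments, if there is one.  A set of samples satisfies
    [collides] throughout as soon as it does so at its [stray] element. *)
Definition stray : Defs.fsym Lall 5 := fun e => xget 0 [set w |
  in_code w (e (o 4)) /\
  ~ collides (e (o 0)) (e (o 1)) (e (o 2)) (e (o 3)) w]%classic.

Lemma few_collisions_nonstandard c (n S T R C : M) : nonstandard n ->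
  rel2 cube_le n (fun1 depth S) -> rel2 cube_le n (fun1 depth T) ->
  (forall w, rel2 in_code w C ->
     [/\ rel2 in_code w (fun1 sample_code n),
         fun2 output S w <> fun2 output T w,
         rel3 edge w (fun2 output S w) (fun2 output R w) &
         rel3 edge w (fun2 output T w) (fun2 output R w)]) ->
  mlt (fun2 muln (num M c) (fun1 card_code C))
    (fun1 card_code (fun1 sample_code n)).
Proof.
move=> /(@nonstandard_ge _ (threshold c)) large dS dT H.
pose w : term Lall 5 := App stray Var.
pose colliding := FAnd (fr2 in_code w (tf1 sample_code (v 0)))
  (FAnd (FNot (FEq (tf2 output (v 1) w) (tf2 output (v 2) w)))
  (FAnd (fr3 edge w (tf2 output (v 1) w) (tf2 output (v 3) w))
     (fr3 edge w (tf2 output (v 2) w) (tf2 output (v 3) w)))).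
pose phi := fimp (fr2 le_nat (tnum 5 (threshold c)) (v 0))
  (fimp (fr2 cube_le (v 0) (tf1 depth (v 1)))
  (fimp (fr2 cube_le (v 0) (tf1 depth (v 2)))
  (fimp (fimp (fr2 in_code w (v 4)) colliding)
    (fr2 lt_nat (tf2 muln (tnum 5 c) (tf1 card_code (v 4)))
      (tf1 card_code (tf1 sample_code (v 0))))))).
have : forall e : 'I_5 -> stdN, sat phi e.
  move=> e; rewrite /phi /colliding !evE => large' dS' dT' stray_collides.
  apply: (@few_collisions _ _ (e (o 1)) (e (o 2)) (e (o 3))) => // x xC.
  apply: contrapT => x_stray.
  have : exists x, _ := ex_intro _ x (conj xC x_stray).
  case/(xgetPex 0); change (xget _ _) with (stray e) => sC; apply.
  by have [? [? [? ?]]] := stray_collides sC.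
move=> /(transfer trueM)/(_ (tnth [tuple n; S; T; R; C])).
rewrite /phi /colliding !evE; apply=> //.
by move=> /H[].
Qed.
End Nonstandard.

(** * The truth value *)

Lemma bsup_bot d (B : ctbDistrLatticeType d) (X : set B) :
  (forall x, X x -> x = \bot%O) -> bsup X = \bot%O.
Proof.
move=> X0; rewrite /bsup; apply: xget_unique.
  split=> [x /X0 ->|x _]; [exact: lexx | exact: le0x].
move=> x [_ x_le]; apply: le_anti.
by rewrite le0x x_le // => y /X0 ->; apply: lexx.
Qed.

Lemma scons_ord0 (T : Type) m (a : T) (e : 'I_m -> T) i :
  val i = 0 -> scons a e i = a.
Proof.
move=> i0; rewrite /scons; case: unliftP => // j /(congr1 val).
by rewrite /= i0.
Qed.

Lemma scons_lift (T : Type) m (a : T) (e : 'I_m -> T) i j :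
  val i = (val j).+1 -> scons a e i = e j.
Proof.
move=> ij; have -> : i = lift ord0 j by apply: val_inj.
by rewrite /scons liftK.
Qed.

Lemma shallow_tree (M : structure Lall) (trueM : true_arithmetic M)
    (n : M) (nonstd_n : nonstandard n) (a : universe n) :
  exists2 T, rel2 cube_le n (fun1 depth T) &
    forall w, sval a w = fun2 output T (sval w).
Proof.
case: a => /= a [[T [_ _ [t t_nonstd rT]] aE] _].
by exists T => //; apply: root_cube_le rT.
Qed.

Lemma negligible_common_neighbor (M : structure Lall)
    (trueM : true_arithmetic M) (n : M) (nonstd_n : nonstandard n)
    (a b g : universe n) (A : cset n) :
  (forall w, val A w ->
     [/\ sval a w <> sval b w, rel3 edge (sval w) (sval a w) (sval g w) &
         rel3 edge (sval w) (sval b w) (sval g w)]) ->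
  negligible A.
Proof.
have [S dS aE] := shallow_tree trueM nonstd_n a.
have [T dT bE] := shallow_tree trueM nonstd_n b.
have [R _ gE] := shallow_tree trueM nonstd_n g.
move=> H c _; have [sub codeE] := codeP A.
apply: (few_collisions_nonstandard trueM c nonstd_n dS dT (R := R)) => w wA.
have wS := sub w wA.
have [] := H (exist _ w wS) ((codeE (exist _ w wS)).2 wA).
by rewrite !aE !bE !gE.
Qed.

Theorem theorem5p11 (M : structure Lall) (trueM : true_arithmetic M)
    (satM : aleph1_saturated M) (n : M) (nonstd_n : nonstandard n) :
  truth collision (noenv : 'I_0 -> limit trueM nonstd_n) = \bot%O.
Proof.
apply: bsup_bot => _ [a _ <-]; apply: bsup_bot => _ [b _ <-].
apply: bsup_bot => _ [g _ <-] /=.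
set e := scons g _.
have -> : e i30 = g by apply: scons_ord0.
have -> : e i31 = b.
  by rewrite /e (@scons_lift _ _ _ _ _ (Ordinal (isT : 0 < 2))) // scons_ord0.
have -> : e i32 = a.
  rewrite /e (@scons_lift _ _ _ _ _ (Ordinal (isT : 1 < 2))) //.
  by rewrite (@scons_lift _ _ _ _ _ (Ordinal (isT : 0 < 1))) // scons_ord0.
rewrite /quot_class; set Q := exist _ _ _.
set P := exist _ _ _; set P' := exist _ _ _.
(* The lattice operations are those of the quotient, by unfolding. *)
change (bmeet (bcompl (bclass trueM nonstd_n Q))
  (bmeet (bclass trueM nonstd_n P) (bclass trueM nonstd_n P'))
  = bclass trueM nonstd_n (cset0 trueM n)).
rewrite bclassC !bclassI; apply: bclassP.
apply: (@negligible_common_neighbor _ trueM _ nonstd_n a b g) => w.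
by rewrite csetDE => -[[[ne [Ea Eb]] _]|[[]]].
Qed.
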